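(* Let $J\subseteq\{(i,j)\mid 1\le i<j\le n\}$ be closed and let $\phi,\eta\in J^*$. Then $$\overline{\chi^\eta(x_\phi)}=\begin{cases} \displaystyle q^{\mathrm{corank}(\eta)-\mathrm{rank}(M_\phi^\eta)}\,\theta(b_0\cdot b_\phi^\eta)\prod_{(i,j)\in \mathrm{supp}(\phi)\cap\mathrm{supp}(\eta)}\theta(\phi_{ij}\eta_{ij}), & \text{if $\phi$ meshes with $\eta$,}\\ 0, & \text{otherwise,}\end{cases}$$ where $b_0\in\mathbb{F}_q^{|J|}$ satisfies $M_\phi^\eta b_0=-a_\phi^\eta$.
   Context: Let $\mathbb{F}_q$ be the finite field with $q$ elements. A set $J\subseteq\{(i,j)\mid 1\le i<j\le n\}$ is closed if $(i,j),(j,k)\in J$ implies $(i,k)\in J$. Let $J^*$ be the set of functions $\phi:J\to\mathbb{F}_q$, $(i,j)\mapsto\phi_{ij}$, and $\mathrm{supp}(\phi)=\{(i,j)\in J\mid \phi_{ij}\ne 0\}$. For $\phi\in J^*$ let $X_\phi$ be the $n\times n$ matrix with $(i,j)$ entry $\phi_{ij}$ for $(i,j)\in J$ and all other entries $0$, and let $x_\phi=1+X_\phi$. Put $\mathfrak{n}_J=\{X_\phi\mid\phi\in J^*\}$ and let $U_J=1+\mathfrak{n}_J$ be the pattern group (a group under matrix multiplication). Write $(i_1,\dots,i_r)\in\mathcal{P}$ if $(i_1,i_2),(i_2,i_3),\dots,(i_{r-1},i_r)\in J$. For $\eta\in J^*$ let $\lambda_\eta:\mathfrak{n}_J\to\mathbb{F}_q$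 be the linear functional $\lambda_\eta(X_\phi)=\sum_{(i,j)\in J}\eta_{ij}\phi_{ij}$. Let $O_\phi=\{uX_\phi v\mid u,v\in U_J\}$. The corank of $\eta$ is the rank of the $|J|\times|J|$ matrix $M_L^\eta$ (rows and columns indexed by $J$) with $(M_L^\eta)_{(j,k),(i,l)}=\eta_{ik}$ if $l=j$ and $(i,j,k)\in\mathcal{P}$, and $0$ otherwise. Fix a nontrivial homomorphism $\theta:\mathbb{F}_q^+\to\mathbb{C}^\times$. The supercharacter $\chi^\eta:U_J\to\mathbb{C}$ is $$\chi^\eta(x_\phi)=\frac{q^{\mathrm{corank}(\eta)}}{|O_\phi|}\sum_{X\in O_\phi}\overline{\theta(\lambda_\eta(X))}.$$ For $\phi,\eta\in J^*$ let $M_\phi^\eta$ be the $|J|\times|J|$ matrix with $(M_\phi^\eta)_{(i,j)(k,l)}=\phi_{jk}\eta_{il}$ if $(i,j,k,l)\in\mathcal{P}$, and $0$ otherwise. Let $a_\phi^\eta,b_\phi^\eta\in\mathbb{F}_q^{|J|}$ (coordinates indexed by $J$) be $$(a_\phi^\eta)_{(i,j)}=\sum_{k:\,(i,j,k)\in\mathcal{P}}\phi_{jk}\eta_{ik},\qquad (b_\phi^\eta)_{(j,k)}=\sum_{i:\,(i,j,k)\in\mathcal{P}}\phi_{ij}\eta_{ik}.$$ One says $\phi$ meshes with $\eta$ if (1) the equation $M_\phi^\eta x=-a_\phi^\eta$ has a solution $x\in\mathbb{F}_q^{|J|}$, and (2) $b_\phi^\eta$ is perpendicular to the nullspace of $M_\phi^\eta$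 with respect to the usual dot product on $\mathbb{F}_q^{|J|}$. *)

(* Defs.v *)
From mathcomp Require Import all_boot all_order all_algebra.
From mathcomp Require Import complex reals.
Set Implicit Arguments.
Unset Strict Implicit.
Unset Printing Implicit Defensive.
Import Order.TTheory GRing.Theory Num.Theory.
Local Open Scope ring_scope.

Section Pattern.
Variables (n : nat) (J : {set 'I_n * 'I_n}).

Definition closed_pattern : Prop :=
  forall i j k : 'I_n, (i, j) \in J -> (j, k) \in J -> (i, k) \in J.

(* (i_1, ..., i_r) \in P, the tuple being given as a sequence *)
Definition chain (s : seq 'I_n) : bool := sorted [rel i j | (i, j) \in J] s.

Definition pidx := {ij : 'I_n * 'I_n | ij \in J}.

Variable F : finFieldType.

Definition pfun := {ffun pidx -> F}.
Implicit Types phi eta : pfun.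

Definition psupp phi : {set pidx} := [set u | phi u != 0].

(* phi_ij, extended by 0 outside J *)
Definition coef phi (i j : 'I_n) : F := oapp phi 0 (insub (i, j)).

Definition pX phi : 'M[F]_n := \matrix_(i, j) coef phi i j.
Definition px phi : 'M[F]_n := 1%:M + pX phi.
Definition nalg : {set 'M[F]_n} := [set pX phi | phi : pfun].
Definition pgroup : {set 'M[F]_n} := [set 1%:M + X | X in nalg].

Definition lam eta (X : 'M[F]_n) : F :=
  \sum_(u : pidx) eta u * X (val u).1 (val u).2.

Definition biorbit (X : 'M[F]_n) : {set 'M[F]_n} :=
  [set u *m X *m v | u in pgroup, v in pgroup].

(* The |J| x |J| matrices and the vectors of F^|J| are indexed by J through
   the enumeration enum_val : 'I_#|J| -> 'I_n * 'I_n. *)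
Definition matJ (f : 'I_n * 'I_n -> 'I_n * 'I_n -> F) : 'M[F]_#|J| :=
  \matrix_(r, s) f (enum_val r) (enum_val s).
Definition vecJ (f : 'I_n * 'I_n -> F) : 'cV[F]_#|J| :=
  \col_r f (enum_val r).
Definition dotJ (x y : 'cV[F]_#|J|) : F := \sum_r x r 0 * y r 0.

Definition ML eta : 'M[F]_#|J| :=
  matJ (fun jk il => let: (j, k) := jk in let: (i, l) := il in
    if (l == j) && chain [:: i; j; k] then coef eta i k else 0).

Definition corank eta : nat := \rank (ML eta).

Definition Mmesh phi eta : 'M[F]_#|J| :=
  matJ (fun ij kl => let: (i, j) := ij in let: (k, l) := kl in
    if chain [:: i; j; k; l] then coef phi j k * coef eta i l else 0).

Definition amesh phi eta : 'cV[F]_#|J| :=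
  vecJ (fun ij => let: (i, j) := ij in
    \sum_(k | chain [:: i; j; k]) coef phi j k * coef eta i k).

Definition bmesh phi eta : 'cV[F]_#|J| :=
  vecJ (fun jk => let: (j, k) := jk in
    \sum_(i | chain [:: i; j; k]) coef phi i j * coef eta i k).

Definition meshes phi eta : Prop :=
  (exists x : 'cV[F]_#|J|, Mmesh phi eta *m x = - amesh phi eta) /\
  (forall x : 'cV[F]_#|J|, Mmesh phi eta *m x = 0 ->
     dotJ (bmesh phi eta) x = 0).

End Pattern.

Definition additive_character (F : finFieldType) (R : realType)
    (theta : F -> complex R) : Prop :=
  (forall x, theta x != 0) /\ {morph theta : x y / x + y >-> x * y}.

Definition nontrivial_character (F : finFieldType) (R : realType)
    (theta : F -> complex R) : Prop :=
  exists x, theta x != 1.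

(* Defined on all matrices, but only meaningful on pgroup J F; for x = px phi
   the orbit below is that of pX phi, see superchar_px. *)
Definition superchar (n : nat) (J : {set 'I_n * 'I_n}) (F : finFieldType)
    (R : realType) (theta : F -> complex R) (eta : pfun J F)
    (x : 'M[F]_n) : complex R :=
  (#|F| ^ corank eta)%:R / #|biorbit J (x - 1%:M)|%:R *
  \sum_(X in biorbit J (x - 1%:M)) (theta (lam eta X))^*.

Section Sanity.
Variables (n : nat) (J : {set 'I_n * 'I_n}) (F : finFieldType).
Implicit Types phi eta : pfun J F.

Lemma coef_val phi (u : pidx J) : coef phi (val u).1 (val u).2 = phi u.
Proof. by rewrite /coef -surjective_pairing valK. Qed.

Lemma coef_notin phi i j : (i, j) \notin J -> coef phi i j = 0.
Proof. by move=> ijJ; rewrite /coef insubN. Qed.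

Lemma lam_pX eta phi : lam eta (pX phi) = \sum_(u : pidx J) eta u * phi u.
Proof. by apply: eq_bigr => u _; rewrite mxE coef_val. Qed.

Lemma superchar_px (R : realType) (theta : F -> complex R) eta phi :
  superchar theta eta (px phi) =
  (#|F| ^ corank eta)%:R / #|biorbit J (pX phi)|%:R *
  \sum_(X in biorbit J (pX phi)) (theta (lam eta X))^*.
Proof. by rewrite /superchar /px addrC addKr. Qed.

End Sanity.

(* Main.v *)
(** Averaging over the orbit of [X = pX phi] is averaging over pairs [(u, v)] of
    elements of the pattern group.  Writing [u = 1 + A], [v = 1 + B] with
    coordinate vectors [x], [y] of [A], [B], one has
    [lam (u X v) = lam X + x . a + y . b + x . (M y)].  Summing [theta] over [x]
    leaves the [y] with [M y = - a]; these form a coset [b0 + ker M], over which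
    [theta (y . b)] sums to 0 unless [b] is orthogonal to [ker M]. *)
Require Import Defs.
From mathcomp Require Import all_boot all_order all_algebra.
From mathcomp Require Import complex reals mxabelem ring.
Set Implicit Arguments.
Unset Strict Implicit.
Unset Printing Implicit Defensive.
Import Order.TTheory GRing.Theory Num.Theory.
Local Open Scope ring_scope.

(** * Averages over a two-sided orbit *)

Lemma sum_inj_stable (T : finType) (V : nmodType) (S : {set T}) (h : T -> T)
    (f : T -> V) :
  {in S &, injective h} -> {in S, forall x, h x \in S} ->
  \sum_(x in S) f (h x) = \sum_(x in S) f x.
Proof.
move=> h_inj hS; rewrite -big_imset //; apply: eq_bigl => x.
suff -> : h @: S = S by [].
apply/eqP; rewrite eqEcard card_in_imset // leqnn andbT.
by apply/subsetP => _ /imsetP[y yS ->]; apply: hS.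
Qed.

Section OrbitAverage.
Variables (F : finFieldType) (n : nat) (U : {set 'M[F]_n}) (X : 'M[F]_n).
Hypothesis U_mul : {in U &, forall u v, u *m v \in U}.
Hypothesis U_unit : {in U, forall u, u \in unitmx}.

(** Both sides equal the triple sum of [f (u *m Y *m v)] over [Y] in [O] and [u], [v] in [U]. For
    fixed [u], [v] the map [Y -> u Y v] permutes [O]; for fixed [Y = u0 X v0] the map
    [(u, v) -> (u u0, v0 v)] permutes the pairs. Stabilizers never have to be counted, and multiples
    replace quotients because [V] is only a monoid. *)
Lemma orbit_average (V : nmodType) (f : 'M[F]_n -> V)
    (O := [set u *m X *m v | u in U, v in U]) :
  (\sum_(Y in O) f Y) *+ (#|U| * #|U|)%N =
  (\sum_(u in U) \sum_(v in U) f (u *m X *m v)) *+ #|O|.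
Proof.
have mulIl u : u \in U -> injective (fun v : 'M[F]_n => u *m v).
  by move=> /U_unit uU; apply: (can_inj (mulKmx uU)).
have mulIr u : u \in U -> injective (fun v : 'M[F]_n => v *m u).
  by move=> /U_unit uU; apply: (can_inj (mulmxK uU)).
rewrite -[RHS]sumr_const.
transitivity (\sum_(Y in O) \sum_(u in U) \sum_(v in U) f (u *m Y *m v)); last first.
  apply: eq_bigr => _ /imset2P[u0 v0 u0U v0U ->].
  have mulU w : w \in U -> {in U, forall u, u *m w \in U}.
    by move=> wU u uU; apply: U_mul.
  have Umul w : w \in U -> {in U, forall u, w *m u \in U}.
    by move=> wU u uU; apply: U_mul.
  rewrite -[RHS](sum_inj_stable _ (in2W (mulIr _ u0U)) (mulU _ u0U)) /=.
  apply: eq_bigr => u uU.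
  rewrite -[RHS](sum_inj_stable _ (in2W (mulIl _ v0U)) (Umul _ v0U)) /=.
  by apply: eq_bigr => v vU; rewrite !mulmxA.
rewrite exchange_big /= mulrnA -!sumr_const; apply: eq_bigr => u uU.
rewrite [RHS]exchange_big; apply: eq_bigr => v vU /=.
rewrite (@sum_inj_stable _ _ O (fun Y => u *m Y *m v)) //.
  by move=> Y Z _ _ /mulIr - /(_ vU) /mulIl; apply.
move=> _ /imset2P[u0 v0 u0U v0U ->].
by apply/imset2P; exists (u *m u0) (v0 *m v); rewrite ?U_mul // !mulmxA.
Qed.

End OrbitAverage.

(** * Vanishing sums, kernels and the dot product *)

(** Translation by [z] permutes [S] and multiplies the sum by [f z], so the sum is killed by
    [f z - 1]. *)
Lemma sum_shift_eq0 (V : finZmodType) (K : idomainType) (f : V -> K)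
    (S : {set V}) (z : V) :
  {in S, forall x, f (x + z) = f x * f z} -> {in S, forall x, x + z \in S} ->
  f z != 1 -> \sum_(x in S) f x = 0.
Proof.
move=> fD Sz fz1; apply/eqP.
suff: (\sum_(x in S) f x) * (f z - 1) == 0 by rewrite mulf_eq0 subr_eq0 (negPf fz1) orbF.
rewrite mulrBr mulr1 subr_eq0 mulr_suml.
rewrite -[eqbRHS](@sum_inj_stable _ _ S (fun x => x + z)) //; last first.
  by move=> x y _ _ /addIr.
by apply/eqP/eq_bigr => x xS; rewrite fD.
Qed.

Lemma card_ker_colmx (F : finFieldType) (m n : nat) (M : 'M[F]_(m, n)) :
  #|[set z : 'cV[F]_n | M *m z == 0]| = (#|F| ^ (n - \rank M))%N.
Proof.
(* Matrix kernels consist of row vectors, so the column solutions are counted as transposes of the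
   rows in the kernel of [M^T]. *)
rewrite -(mxrank_tr M) -mxrank_ker -card_rowg.
rewrite -(card_imset _ (@trmx_inj _ n 1)); apply: eq_card => z.
rewrite mem_rowg sub_kermx; apply/imsetP/idP.
  by case=> y; rewrite inE => /eqP My ->; rewrite -trmx_mul My trmx0.
move=> /eqP zM; exists z^T; last by rewrite trmxK.
by rewrite inE -[M]trmxK -trmx_mul zM trmx0.
Qed.

Section Dot.
Variables (n : nat) (J : {set 'I_n * 'I_n}) (F : finFieldType).
Implicit Types x y z : 'cV[F]_#|J|.

Lemma dotJC x y : dotJ x y = dotJ y x.
Proof. by apply: eq_bigr => r _; rewrite mulrC. Qed.

Lemma dotJDr x y z : dotJ x (y + z) = dotJ x y + dotJ x z.
Proof. by rewrite -big_split; apply: eq_bigr => r _; rewrite mxE mulrDr. Qed.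

Lemma dotJ_delta r (c : F) y : dotJ (c *: delta_mx r 0) y = c * y r 0.
Proof.
rewrite /dotJ (bigD1 r) //= !mxE !eqxx mulr1 big1 ?addr0 // => s /negPf sr.
by rewrite !mxE sr mulr0 mul0r.
Qed.

End Dot.

(** * Sums of an additive character over vectors *)

Section CharacterSums.
Variables (F : finFieldType) (R : realType) (theta : F -> complex R).
Hypothesis theta_char : additive_character theta.
Hypothesis theta_nontriv : nontrivial_character theta.

Let thetaD : {morph theta : x y / x + y >-> x * y} := theta_char.2.

Lemma character0 : theta 0 = 1.
Proof. by apply: (mulIf (theta_char.1 0)); rewrite -thetaD addr0 mul1r. Qed.

Lemma character_sum (I : finType) (P : pred I) (f : I -> F) :
  theta (\sum_(i | P i) f i) = \prod_(i | P i) theta (f i).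
Proof. exact: (big_morph theta thetaD character0). Qed.

Variables (n : nat) (J : {set 'I_n * 'I_n}).
Implicit Types a b c x y z : 'cV[F]_#|J|.

Lemma sum_character_dot c :
  \sum_(x : 'cV[F]_#|J|) theta (dotJ x c) = if c == 0 then (#|F| ^ #|J|)%:R else 0.
Proof.
case: eqP => [->|/eqP c0].
  rewrite (eq_bigr (fun=> 1)) => [|x _]; last first.
    by rewrite /dotJ big1 ?character0 // => r _; rewrite mxE mulr0.
  by rewrite sumr_const card_mx muln1.
have [r cr] : exists r, c r 0 != 0.
  apply/existsP; apply: contraNT c0; rewrite negb_exists => /forallP c0.
  by apply/eqP/colP => r; rewrite mxE; apply/eqP; move: (c0 r); rewrite negbK.
have [t t1] := theta_nontriv.
rewrite -(eq_bigl _ _ (@in_setT _)).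
(* The shift is supported where [c] is nonzero and scaled so that its dot product with [c] is [t], a
   point where [theta] is not 1. *)
apply: (@sum_shift_eq0 _ _ _ _ ((t / c r 0) *: delta_mx r 0)).
- by move=> x _; rewrite dotJC dotJDr thetaD !(dotJC c).
- by move=> x _; rewrite in_setT.
by rewrite dotJ_delta divfK.
Qed.

Variables (M : 'M[F]_#|J|) (a b : 'cV[F]_#|J|).

(** For fixed [y] the terms in [x] combine to [dotJ x (M *m y + a)], and orthogonality of characters
    leaves only the [y] with [M *m y = - a]. *)
Lemma bilinear_character_sum :
  \sum_(x : 'cV[F]_#|J|) \sum_(y : 'cV[F]_#|J|)
     theta (dotJ x a + dotJ y b + dotJ x (M *m y)) =
  (#|F| ^ #|J|)%:R * \sum_(y | M *m y == - a) theta (dotJ y b).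
Proof.
rewrite exchange_big /= mulr_sumr [RHS]big_mkcond; apply: eq_bigr => y _.
transitivity (theta (dotJ y b) * \sum_(x : 'cV[F]_#|J|) theta (dotJ x (M *m y + a))).
  rewrite mulr_sumr; apply: eq_bigr => x _; rewrite -thetaD dotJDr.
  by congr theta; rewrite [LHS]addrC [RHS]addrC addrA.
rewrite sum_character_dot addr_eq0.
by case: ifP => _; rewrite ?mulr0 // mulrC.
Qed.

Lemma coset_character_sum b0 : M *m b0 = - a ->
  \sum_(y | M *m y == - a) theta (dotJ y b) =
  theta (dotJ b0 b) * \sum_(z in [set z | M *m z == 0]) theta (dotJ z b).
Proof.
move=> Mb0; rewrite (reindex_inj (addrI b0)) /= mulr_sumr.
apply: eq_big => [z|z _]; last by rewrite dotJC dotJDr thetaD !(dotJC b).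
by rewrite inE mulmxDr Mb0 -subr_eq0 opprK addrAC addNr add0r.
Qed.

Lemma ker_character_sum :
  (forall z, M *m z = 0 -> dotJ b z = 0) ->
  \sum_(z in [set z | M *m z == 0]) theta (dotJ z b) =
  (#|F| ^ (#|J| - \rank M))%:R.
Proof.
move=> bM; rewrite -card_ker_colmx -sumr_const; apply: eq_bigr => z.
by rewrite inE => /eqP Mz; rewrite dotJC bM ?character0.
Qed.

Lemma ker_character_sum_eq0 z : M *m z = 0 -> dotJ b z != 0 ->
  \sum_(z in [set z | M *m z == 0]) theta (dotJ z b) = 0.
Proof.
move=> Mz bz; have [t t1] := theta_nontriv.
(* This multiple of [z] stays in the kernel and pairs with [b] to give [t]. *)
apply: (@sum_shift_eq0 _ _ _ _ ((t / dotJ b z) *: z)).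
- by move=> x _; rewrite dotJC dotJDr thetaD !(dotJC b).
- move=> x; rewrite !inE => /eqP Mx.
  by rewrite mulmxDr Mx -scalemxAr Mz scaler0 addr0.
suff -> : dotJ ((t / dotJ b z) *: z) b = t by [].
rewrite -[RHS](divfK bz) /dotJ mulr_sumr; apply: eq_bigr => r _.
by rewrite !mxE -!mulrA [z r 0 * _]mulrC.
Qed.

End CharacterSums.

(** * Coordinates on the pattern group and the pairing [lam] *)

Section PatternCoordinates.
Variables (n : nat) (J : {set 'I_n * 'I_n}) (F : finFieldType).
Implicit Types (phi eta : pfun J F) (x y : 'cV[F]_#|J|).

Definition vmx x : 'M[F]_n :=
  \sum_r x r 0 *: delta_mx (enum_val r).1 (enum_val r).2.

Lemma vmx_val x r : vmx x (enum_val r).1 (enum_val r).2 = x r 0.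
Proof.
rewrite summxE (bigD1 r) //= !mxE !eqxx mulr1 big1 ?addr0 // => s sr.
rewrite !mxE -xpair_eqE -!surjective_pairing (inj_eq enum_val_inj).
by rewrite eq_sym (negPf sr) mulr0.
Qed.

Lemma vmx_notin x i j : (i, j) \notin J -> vmx x i j = 0.
Proof.
move=> ijJ; rewrite summxE big1 // => r _; rewrite !mxE.
case: andP => [[/eqP ei /eqP ej]|]; last by rewrite mulr0.
by case/negP: ijJ; rewrite ei ej -surjective_pairing enum_valP.
Qed.

Lemma nalgP (X : 'M[F]_n) :
  reflect (forall i j, (i, j) \notin J -> X i j = 0) (X \in nalg J F).
Proof.
apply: (iffP imsetP) => [[phi _ ->] i j ijJ|XJ].
  by rewrite mxE coef_notin.
exists [ffun u => X (val u).1 (val u).2] => //; apply/matrixP => i j.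
rewrite mxE; case: (boolP ((i, j) \in J)) => ijJ; last by rewrite XJ // coef_notin.
by rewrite /coef insubT /= ffunE.
Qed.

Lemma vmx_nalg : nalg J F = [set vmx x | x in 'cV[F]_#|J|].
Proof.
apply/setP => X; apply/nalgP/imsetP => [XJ|[x _ ->] i j]; last exact: vmx_notin.
exists (\col_r X (enum_val r).1 (enum_val r).2) => //; apply/matrixP => i j.
case: (boolP ((i, j) \in J)) => ijJ; last by rewrite XJ // vmx_notin.
have /= := vmx_val (\col_r X (enum_val r).1 (enum_val r).2) (enum_rank_in ijJ (i, j)).
by rewrite enum_rankK_in // mxE enum_rankK_in.
Qed.

Lemma vmx_inj : injective vmx.
Proof. by move=> x y exy; apply/colP => r; rewrite -!vmx_val exy. Qed.

(** [vmx] is a bijection from vectors onto [nalg]. The values lie in an arbitrary monoid so that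
    [V = nat] also yields the order of the group. *)
Lemma sum_pgroup (V : nmodType) (f : 'M[F]_n -> V) :
  \sum_(u in pgroup J F) f u = \sum_(x : 'cV[F]_#|J|) f (1%:M + vmx x).
Proof.
rewrite /pgroup vmx_nalg -imset_comp big_imset //=.
by move=> x y _ _ /addrI /vmx_inj.
Qed.

Lemma card_pgroup : #|pgroup J F| = (#|F| ^ #|J|)%N.
Proof.
by rewrite -sum1_card [LHS](@sum_pgroup nat) sum1_card card_mx muln1.
Qed.

(** [(1 + A)(1 + B) = 1 + (A + B + A B)], and closedness of [J] keeps the support of [A B] inside
    [J]. *)
Lemma pgroup_mul : closed_pattern J ->
  {in pgroup J F &, forall u v, u *m v \in pgroup J F}.
Proof.
move=> Jcl _ _ /imsetP[A /nalgP AJ ->] /imsetP[B /nalgP BJ ->].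
apply/imsetP; exists (A + B + A *m B); last first.
  by rewrite mulmxDr mulmx1 mulmxDl mul1mx addrA !addrA.
apply/nalgP => i j ijJ; rewrite !mxE AJ // BJ // !add0r big1 // => k _.
case: (boolP ((i, k) \in J)) => ik; last by rewrite AJ // mul0r.
rewrite [B k j]BJ ?mulr0 //; apply: contra ijJ; exact: Jcl.
Qed.

Lemma pgroup_unit : (forall i j : 'I_n, (i, j) \in J -> (i < j)%N) ->
  {in pgroup J F, forall u, u \in unitmx}.
Proof.
(* The matrix is upper unitriangular; transposing makes it lower triangular, the form that
   [det_trig] expects. *)
move=> Jup _ /imsetP[A /nalgP AJ ->]; rewrite -unitmx_tr unitmxE.
rewrite det_trig; last first.
  apply/is_trig_mxP => i j ij; rewrite !mxE AJ; last first.
    by apply/negP => /Jup; rewrite ltnNge ltnW.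
  by rewrite addr0 -val_eqE gtn_eqF.
rewrite big1 ?unitr1 // => i _; rewrite !mxE eqxx AJ ?addr0 //.
by apply/negP => /Jup; rewrite ltnn.
Qed.

Lemma sum_enum_val (f : 'I_n -> 'I_n -> F) :
  (forall i j, (i, j) \notin J -> f i j = 0) ->
  \sum_(r < #|J|) f (enum_val r).1 (enum_val r).2 = \sum_i \sum_j f i j.
Proof.
move=> fJ; rewrite -(big_enum_val (fun p => f p.1 p.2)) /= pair_big /=.
rewrite big_mkcond; apply: eq_bigr => -[i j] _ /=.
by case: ifP => // /negbT /fJ.
Qed.

Lemma lamE eta (X : 'M[F]_n) : lam eta X = \sum_i \sum_j coef eta i j * X i j.
Proof.
rewrite pair_big /lam (eq_bigr (fun u => coef eta (val u).1 (val u).2 *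
  X (val u).1 (val u).2)) => [|u _]; last by rewrite coef_val.
rewrite -(big_sub (mem J) (fun p => coef eta p.1 p.2 * X p.1 p.2)) big_mkcond.
apply: eq_bigr => -[i j] _ /=; case: ifPn => // ijJ.
by rewrite coef_notin ?mul0r.
Qed.

(** The values of [g] outside [J] are arbitrary, since [vmx x] vanishes there. This allows the
    pairings below to be compared as sums over unrestricted indices. *)
Lemma dotJ_vmx x (v : 'cV[F]_#|J|) (g : 'I_n -> 'I_n -> F) :
  (forall r, v r 0 = g (enum_val r).1 (enum_val r).2) ->
  dotJ x v = \sum_i \sum_j vmx x i j * g i j.
Proof.
move=> vg; rewrite -sum_enum_val => [|i j ijJ]; last by rewrite vmx_notin ?mul0r.
by apply: eq_bigr => r _; rewrite vmx_val vg.
Qed.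

(** Both sides are sums over [i, j, k] of [x_ij phi_jk eta_ik]; when [(i, j, k)] is not a chain,
    [x_ij] or [phi_jk] is already 0. *)
Lemma lam_mull phi eta x :
  lam eta (vmx x *m pX phi) = dotJ x (amesh phi eta).
Proof.
rewrite (@dotJ_vmx _ _ (fun i j =>
  \sum_(k | chain J [:: i; j; k]) coef phi j k * coef eta i k)) => [|r]; last first.
  by rewrite mxE; case: (enum_val r).
rewrite lamE; apply: eq_bigr => i _.
under eq_bigr => k do rewrite mxE mulr_sumr.
rewrite exchange_big; apply: eq_bigr => j _; rewrite mulr_sumr [RHS]big_mkcond.
apply: eq_bigr => k _; rewrite mxE /chain /= andbT.
case: ifPn; first by rewrite mulrCA [coef eta _ _ * _]mulrC.
rewrite negb_and => /orP[ij|jk]; first by rewrite vmx_notin // !(mul0r, mulr0).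
by rewrite (coef_notin _ jk) !mulr0.
Qed.

Lemma lam_mulr phi eta y :
  lam eta (pX phi *m vmx y) = dotJ y (bmesh phi eta).
Proof.
rewrite (@dotJ_vmx _ _ (fun j k =>
  \sum_(i | chain J [:: i; j; k]) coef phi i j * coef eta i k)) => [|r]; last first.
  by rewrite mxE; case: (enum_val r).
rewrite lamE exchange_big [RHS]exchange_big; apply: eq_bigr => k _ /=.
under eq_bigr => i do rewrite mxE mulr_sumr.
rewrite exchange_big; apply: eq_bigr => j _; rewrite mulr_sumr [RHS]big_mkcond.
apply: eq_bigr => i _; rewrite mxE /chain /= andbT.
case: ifPn; first by rewrite mulrA mulrC [coef eta _ _ * _]mulrC.
rewrite negb_and => /orP[ij|jk]; last by rewrite vmx_notin // !(mul0r, mulr0).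
by rewrite (coef_notin _ ij) mul0r !mulr0.
Qed.

Lemma lam_mulmm phi eta x y :
  lam eta (vmx x *m pX phi *m vmx y) = dotJ x (Mmesh phi eta *m y).
Proof.
rewrite (@dotJ_vmx _ _ (fun i j => \sum_k \sum_l
  (if chain J [:: i; j; k; l] then coef phi j k * coef eta i l else 0)
   * vmx y k l)) => [|r]; last first.
  rewrite mxE -sum_enum_val => [|k l kl]; last by rewrite vmx_notin ?mulr0.
  apply: eq_bigr => s _; rewrite vmx_val mxE.
  by case: (enum_val r); case: (enum_val s).
rewrite lamE; apply: eq_bigr => i _.
under eq_bigr => l _.
  rewrite mxE mulr_sumr; under eq_bigr => k do rewrite mxE mulr_suml mulr_sumr.
  over.
under [RHS]eq_bigr => j _.
  rewrite mulr_sumr; under eq_bigr => k do rewrite mulr_sumr.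
  over.
(* Inside the sum over [i], the left side runs over [l, k, j] and the right side over [j, k, l];
   three exchanges align them. *)
rewrite [RHS]exchange_big; under [RHS]eq_bigr do rewrite exchange_big.
rewrite [RHS]exchange_big; apply: eq_bigr => l _; apply: eq_bigr => k _.
apply: eq_bigr => j _; rewrite mxE /chain /= andbT.
case: ifPn => [_|]; first by rewrite mulrC -!mulrA [vmx y k l * _]mulrC.
rewrite !negb_and => /or3P[ij|jk|kl].
- by rewrite (vmx_notin _ ij) !(mul0r, mulr0).
- by rewrite (coef_notin _ jk) !(mul0r, mulr0).
- by rewrite (vmx_notin _ kl) !(mul0r, mulr0).
Qed.

Lemma lamD eta X Y : lam eta (X + Y) = lam eta X + lam eta Y.
Proof. by rewrite -big_split; apply: eq_bigr => u _; rewrite mxE mulrDr. Qed.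

Lemma lam_biorbit phi eta x y :
  lam eta ((1%:M + vmx x) *m pX phi *m (1%:M + vmx y)) =
  lam eta (pX phi) + (dotJ x (amesh phi eta) + dotJ y (bmesh phi eta)
    + dotJ x (Mmesh phi eta *m y)).
Proof.
rewrite mulmxDl mul1mx mulmxDr mulmx1 mulmxDl !lamD.
by rewrite lam_mull lam_mulr lam_mulmm !addrA.
Qed.

End PatternCoordinates.

(** * The supercharacter formula *)

Section SuperCharacter.
Variables (F : finFieldType) (R : realType) (theta : F -> complex R).
Hypothesis theta_char : additive_character theta.
Hypothesis theta_nontriv : nontrivial_character theta.
Variables (n : nat) (J : {set 'I_n * 'I_n}).
Hypothesis J_upper : forall i j : 'I_n, (i, j) \in J -> (i < j)%N.
Hypothesis J_closed : closed_pattern J.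
Variables phi eta : pfun J F.

(** Indices outside the common support contribute [theta 0 = 1]. *)
Lemma theta_lam_pX : theta (lam eta (pX phi)) =
  \prod_(u in psupp phi :&: psupp eta) theta (phi u * eta u).
Proof.
rewrite lam_pX character_sum // [RHS]big_mkcond; apply: eq_bigr => u _.
rewrite !inE mulrC; case: ifPn => //; rewrite negb_and !negbK.
by case/orP => /eqP ->; rewrite ?(mul0r, mulr0) character0.
Qed.

(** There are [q^(2|J|)] pairs [(u, v)], where [q] is the order of [F]; summing over the coordinates
    of [u] gives back one factor [q^|J|], so one remains in the denominator. *)
Lemma orbit_character_average :
  (\sum_(X in biorbit J (pX phi)) theta (lam eta X)) / #|biorbit J (pX phi)|%:R =
  theta (lam eta (pX phi)) / (#|F| ^ #|J|)%:R *
    \sum_(y | Mmesh phi eta *m y == - amesh phi eta) theta (dotJ y (bmesh phi eta)).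
Proof.
have U_gt0 : (0 < #|pgroup J F|)%N.
  by rewrite card_pgroup expn_gt0 (ltnW (card_finNzRing_gt1 F)).
have q0 : (#|F| ^ #|J|)%:R != 0 :> complex R.
  by rewrite -card_pgroup pnatr_eq0 -lt0n.
have O0 : #|biorbit J (pX phi)|%:R != 0 :> complex R.
  have /card_gt0P[u uU] := U_gt0; rewrite pnatr_eq0 -lt0n; apply/card_gt0P.
  by exists (u *m pX phi *m u); apply/imset2P; exists u u.
set T := (X in _ = _ * X).
have sumE : \sum_(u in pgroup J F) \sum_(v in pgroup J F)
    theta (lam eta (u *m pX phi *m v)) =
    theta (lam eta (pX phi)) * ((#|F| ^ #|J|)%:R * T).
  rewrite sum_pgroup /T -(bilinear_character_sum theta_char theta_nontriv) mulr_sumr.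
  apply: eq_bigr => x _; rewrite sum_pgroup mulr_sumr; apply: eq_bigr => y _.
  by rewrite lam_biorbit theta_char.2.
have /= := orbit_average (pX phi) (pgroup_mul (F := F) J_closed)
  (pgroup_unit (F := F) J_upper) (fun X => theta (lam eta X)).
rewrite -/(biorbit J (pX phi)) sumE card_pgroup.
rewrite -[LHS]mulr_natr -[RHS]mulr_natr natrM => e.
(* Multiplying by the orbit size and twice by [q^|J|] turns the left side into that of [e]. *)
apply: (mulIf O0); apply: (mulIf q0); apply: (mulIf q0).
by rewrite divfK // -mulrA e; field.
Qed.

(** No meshing is assumed: both cases of the theorem are read off from the remaining sum over
    solutions [y]. *)
Lemma conj_superchar : (superchar theta eta (px phi))^* =
  (#|F| ^ corank eta)%:R * theta (lam eta (pX phi)) / (#|F| ^ #|J|)%:R *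
    \sum_(y | Mmesh phi eta *m y == - amesh phi eta) theta (dotJ y (bmesh phi eta)).
Proof.
rewrite superchar_px rmorphM fmorph_div !rmorph_nat rmorph_sum /=.
under eq_bigr do rewrite conjCK.
by rewrite mulrAC -[LHS]mulrA orbit_character_average !mulrA.
Qed.

End SuperCharacter.

Theorem theorem5p1 (F : finFieldType) (R : realType) (theta : F -> complex R)
    (theta_char : additive_character theta)
    (theta_nontriv : nontrivial_character theta)
    (n : nat) (J : {set 'I_n * 'I_n})
    (J_upper : forall i j : 'I_n, (i, j) \in J -> (i < j)%N)
    (J_closed : closed_pattern J)
    (phi eta : pfun J F) :
  (meshes phi eta ->
   forall b0 : 'cV[F]_#|J|, Mmesh phi eta *m b0 = - amesh phi eta ->
     (superchar theta eta (px phi))^* =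
       #|F|%:R ^ ((corank eta)%:Z - (\rank (Mmesh phi eta))%:Z)
       * theta (dotJ b0 (bmesh phi eta))
       * \prod_(u in psupp phi :&: psupp eta) theta (phi u * eta u)) /\
  (~ meshes phi eta -> (superchar theta eta (px phi))^* = 0).
Proof.
set M := Mmesh phi eta; set a := amesh phi eta; set b := bmesh phi eta.
rewrite conj_superchar //; split=> [[_ bM] b0 Mb0 | nmesh].
  have q0 : #|F|%:R != 0 :> complex R.
    by rewrite pnatr_eq0 -lt0n (ltnW (card_finNzRing_gt1 F)).
  rewrite (coset_character_sum theta_char b Mb0) (ker_character_sum theta_char) //.
  rewrite -theta_lam_pX // !natrX expfzDr // -invr_expz -!exprnP.
  (* Splitting [q^|J|] as [q^(|J| - rank M) * q^(rank M)] lets the first factor cancel the size of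
     the kernel. *)
  rewrite -[in X in X * (_ * _)](subnK (rank_leq_row M)) exprD.
  have qk0 k : #|F|%:R ^+ k != 0 :> complex R by rewrite expf_neq0.
  (* [field] on the goal itself diverges: it tries to compute with the exponents. *)
  have cancel (k l c t p : complex R) : k != 0 -> l != 0 ->
      c * p / (k * l) * (t * k) = c / l * t * p by move=> *; field; apply/andP.
  exact: cancel.
(* Finite search decides how meshing fails: without a solution the sum is empty; with a kernel
   vector not orthogonal to [b] it cancels; otherwise [phi] meshes with [eta], a contradiction. *)
have [b0 Mb0 | nosol] := pickP (fun y => M *m y == - a); last first.
  by rewrite big_pred0 ?mulr0.
have [z /andP[/eqP Mz bz] | bM] := pickP (fun z => (M *m z == 0) && (dotJ b z != 0)).
  rewrite (coset_character_sum theta_char b (eqP Mb0)).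
  by rewrite (ker_character_sum_eq0 theta_char theta_nontriv Mz bz) !mulr0.
case: nmesh; split=> [|z /eqP Mz]; first by exists b0; apply/eqP.
by have := bM z; rewrite Mz => /negbFE/eqP.
Qed.
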